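(* Let $M$ be a strictly monotone Möbius structure on the circle $X=S^1$ that satisfies the Increment axiom (I). Then there is a complete, proper, geodesic (Gromov) hyperbolic metric space $Y$ with boundary at infinity $\partial_\infty Y=S^1$, for which the induced Möbius structure $M_Y$ on $\partial_\infty Y$ is isomorphic to $M$, $M_Y=M$.
   Context: Semi-metrics and Möbius structures. A semi-metric on a set $X$ is a symmetric function $d:X^2\to\mathbb{R}\cup\{\infty\}$, written $d(x,y)=|xy|$, vanishing on the diagonal, positive off the diagonal, with at most one infinitely remote point $\omega\in X$, i.e. a point with $d(x,\omega)=\infty$ for some $x\ne\omega$; if $\omega$ is such a point then $d(x,\omega)=\infty$ for all $x\neq\omega$. Two semi-metrics are Möbius equivalent if they have the same cross-ratios on every 4-tuple of pairwise distinct points, where for $q=(x_1,x_2,x_3,x_4)$ $$\mathrm{cr}_1(q)=\frac{|x_1x_3||x_2x_4|}{|x_1x_4||x_2x_3|},\quad \mathrm{cr}_2(q)=\frac{|x_1x_4||x_2x_3|}{|x_1x_2||x_3x_4|},\quad \mathrm{cr}_3(q)=\frac{|x_1x_2||x_3x_4|}{|x_2x_4||x_1x_3|}.$$ If one point is infinitely remote, the infinite distances in numerator and denominator are cancelled; the same cancellation convention is used in all equalities and inequalities between products of distances below. A Möbius structure $M$ on $X$ is a class of Möbius equivalent semi-metrics on $X$. For each $\omega\in X$ there is a semi-metric $d_\omega\in M$ with infinitely remote point $\omega$, unique up to homothety. The $M$-topology on $X$ has as subbase all open balls centered at finite points of all semi-metrics from $M$ having infinitely remote points. Strict monotonicity.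 Fix a constant $\alpha$ with $\sqrt2-1\le\alpha<1$. Two pairs of points of $S^1$ separate each other if all four points are distinct and each of the two open arcs determined by one pair contains exactly one point of the other pair. A Möbius structure $M$ on $X=S^1$ is strictly monotone if: (T) the $M$-topology is the usual topology of $S^1$; (M($\alpha$)) for every 4-tuple $(x,y,z,u)\in X^4$ such that the pairs $(x,y)$, $(z,u)$ separate each other, $|xy||zu|\ge\max\{|xz||yu|+\alpha|xu||yz|,\ \alpha|xz||yu|+|xu||yz|\}$ for some and hence any semi-metric from $M$; (P) for every $(x,y,z,u)\in X^4$, $|xy||zu|\le|xz||yu|+|xu||yz|$ for some and hence any semi-metric from $M$. Increment axiom (I). For every 7-tuple $q=(x_1,\dots,x_7)$ of pairwise distinct points of $S^1$ in the cyclic order $x_1x_2x_3x_4x_5x_6x_7$, and for $I\subset\{1,\dots,7\}$, let $q_I$ be the tuple obtained from $q$ by crossing out the entries with indices in $I$ (keeping the order). If $q_{247}=(x_1,x_3,x_5,x_6)$ and $q_{157}=(x_2,x_3,x_4,x_6)$ are harmonic, i.e. $\mathrm{cr}_2(q_{247})=1=\mathrm{cr}_2(q_{157})$ (equivalently $|x_1x_3||x_5x_6|=|x_1x_6||x_3x_5|$ and $|x_2x_3||x_4x_6|=|x_2x_6||x_3x_4|$), then $\mathrm{cr}_1(q_{345})>\mathrm{cr}_1(q_{123})$, where $q_{345}=(x_1,x_2,x_6,x_7)$ and $q_{123}=(x_4,x_5,x_6,x_7)$. Induced Möbius structure. For a Gromov hyperbolic space $Y$ let $(y|z)_o=\frac12(|yo|+|zo|-|yz|)$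 be the Gromov product and $\partial_\infty Y$ the Gromov boundary at infinity. $Y$ is boundary continuous if for all $\xi,\eta\in\partial_\infty Y$, $o\in Y$, and all sequences $\{y_i\}\in\xi$, $\{z_i\}\in\eta$, the limit $(\xi|\eta)_o=\lim_i(y_i|z_i)_o$ exists (and so does not depend on the chosen sequences). Then the semi-metrics $d_o(\xi,\eta)=e^{-(\xi|\eta)_o}$, $o\in Y$, on $\partial_\infty Y$ are Möbius equivalent and define the Möbius structure $M_Y$ induced by $Y$. The statement that $Y$ induces $M_Y$ includes that $Y$ is boundary continuous. The isomorphism $M_Y=M$ is with respect to the identification $\partial_\infty Y=S^1$. *)

(* Defs.v *)
From HB Require Import structures.
From mathcomp Require Import all_boot all_order all_algebra.
From mathcomp Require Import all_classical all_reals all_analysis.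

Set Implicit Arguments.
Unset Strict Implicit.
Unset Printing Implicit Defensive.

Import Order.TTheory GRing.Theory Num.Theory.
Import numFieldNormedType.Exports.

Local Open Scope classical_set_scope.
Local Open Scope ring_scope.

Section Moebius.
Context {R : realType} {X : choiceType}.
Implicit Types (d : X -> X -> \bar R) (M : set (X -> X -> \bar R)).

Definition infinitely_remote d (w : X) := forall x, x != w -> d x w = +oo%E.

Record is_semimetric d : Prop := IsSemimetric {
  semimetric_sym : forall x y, d x y = d y x;
  semimetric_diag : forall x, d x x = 0%E;
  semimetric_pos : forall x y, x != y -> (0 < d x y)%E;
  semimetric_infinite : forall x y, d x y = +oo%E ->
    infinitely_remote d x \/ infinitely_remote d y;
  semimetric_remote_uniq : forall w w',
    infinitely_remote d w -> infinitely_remote d w' -> w = w' }.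

(* Cancellation of infinite distances.  If x, y, z, u are pairwise distinct and
   one of them is infinitely remote, then each of the products |xy||zu|,
   |xz||yu|, |xu||yz| has exactly one infinite factor, so the infinite factors
   are cancelled by replacing each of them by 1. *)
Definition cdist d (x y : X) : R :=
  if d x y == +oo%E then 1 else fine (d x y).

Definition cprod d (x y z u : X) : R := cdist d x y * cdist d z u.

Definition cr1 d (x1 x2 x3 x4 : X) : R :=
  cprod d x1 x3 x2 x4 / cprod d x1 x4 x2 x3.
Definition cr2 d (x1 x2 x3 x4 : X) : R :=
  cprod d x1 x4 x2 x3 / cprod d x1 x2 x3 x4.
Definition cr3 d (x1 x2 x3 x4 : X) : R :=
  cprod d x1 x2 x3 x4 / cprod d x2 x4 x1 x3.

Definition moebius_equiv d d' := forall x1 x2 x3 x4 : X,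
  uniq [:: x1; x2; x3; x4] ->
  [/\ cr1 d x1 x2 x3 x4 = cr1 d' x1 x2 x3 x4,
      cr2 d x1 x2 x3 x4 = cr2 d' x1 x2 x3 x4 &
      cr3 d x1 x2 x3 x4 = cr3 d' x1 x2 x3 x4].

Definition is_moebius_structure M := exists2 d0, is_semimetric d0 &
  M = [set d | is_semimetric d /\ moebius_equiv d0 d].

Definition moebius_subbase M : set (set X) :=
  [set B | exists d w x (r : R),
     [/\ M d, infinitely_remote d w, x != w, 0 < r &
         B = [set y | (d x y < r%:E)%E]]].

Definition moebius_open M (U : set X) :=
  exists2 F : set (set X), F `<=` finI_from (moebius_subbase M) id &
    U = \bigcup_(V in F) V.

End Moebius.

Section Circle.
Context {R : realType}.

Definition circle : set (R * R) := [set p | p.1 ^+ 2 + p.2 ^+ 2 = 1].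

Definition ccw_order (s : seq circle) := exists t : seq R,
  [/\ sorted <%R t, last 0 t < head 0 t + 2 * pi &
      [seq set_val p | p <- s] = [seq (cos a, sin a) | a <- t]].

(* The circle is not oriented: both directions are allowed. *)
Definition cyclic_order (s : seq circle) := ccw_order s \/ ccw_order (rev s).

(* For x != y, the two open arcs determined by the pair (x, y) are
   open_arc x y and open_arc y x. *)
Definition open_arc (x y : circle) : set circle :=
  [set z | ccw_order [:: x; z; y]].

Definition separate (x y z u : circle) :=
  [/\ uniq [:: x; y; z; u],
      open_arc x y z <-> ~ open_arc x y u &
      open_arc y x z <-> ~ open_arc y x u].

Implicit Type M : set (circle -> circle -> \bar R).

Definition axiom_T M := forall U : set circle, moebius_open M U <-> open U.

Definition axiom_M (alpha : R) M := forall d, M d ->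
  forall x y z u : circle, separate x y z u ->
  Num.max (cprod d x z y u + alpha * cprod d x u y z)
          (alpha * cprod d x z y u + cprod d x u y z) <= cprod d x y z u.

(* For tuples with coinciding points this is automatic, with an infinitely
   remote point or without: the left-hand side is 0 if x = y or z = u, and it
   equals one of the two terms on the right otherwise. *)
Definition axiom_P M := forall d, M d -> forall x y z u : circle,
  cprod d x y z u <= cprod d x z y u + cprod d x u y z.

Definition strictly_monotone (alpha : R) M :=
  [/\ axiom_T M, axiom_M alpha M & axiom_P M].

Definition increment_axiom M := forall d, M d ->
  forall x1 x2 x3 x4 x5 x6 x7 : circle,
  cyclic_order [:: x1; x2; x3; x4; x5; x6; x7] ->
  cr2 d x1 x3 x5 x6 = 1 -> cr2 d x2 x3 x4 x6 = 1 ->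
  cr1 d x1 x2 x6 x7 > cr1 d x4 x5 x6 x7.

End Circle.
Arguments circle : clear implicits.

Section Hyperbolic.
Context {R : realType} (Y : metricType R).

Definition metric_complete := forall F : set_system Y,
  ProperFilter F -> cauchy F -> exists x : Y, F --> x.

Definition metric_proper := forall (x : Y) (r : R),
  compact [set y : Y | mdist x y <= r].

Definition geodesic := forall x y : Y, exists g : R -> Y,
  [/\ g 0 = x, g (mdist x y) = y &
      {in `[0, mdist x y] &, forall s t, mdist (g s) (g t) = `|s - t|}].

Definition gromov_product (o y z : Y) : R :=
  (mdist y o + mdist z o - mdist y z) / 2.

Definition gromov_hyperbolic := exists delta : R, forall o x y z : Y,
  Num.min (gromov_product o x y) (gromov_product o y z) - delta
    <= gromov_product o x z.

Definition converges_to_infinity (u : nat -> Y) := forall (o : Y) (A : R),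
  \forall i & j \near \oo, A <= gromov_product o (u i) (u j).

Definition gromov_equivalent (u v : nat -> Y) := forall o : Y,
  gromov_product o (u i) (v i) @[i --> \oo] --> +oo.

Definition boundary : set (set (nat -> Y)) :=
  [set xi | exists2 u, converges_to_infinity u &
     xi = [set v | converges_to_infinity v /\ gromov_equivalent u v]].

Definition is_boundary_product (o : Y) (xi eta : boundary) (l : \bar R) :=
  forall y z : nat -> Y, set_val xi y -> set_val eta z ->
    (gromov_product o (y i) (z i))%:E @[i --> \oo] --> l.

Definition boundary_continuous := forall (o : Y) (xi eta : boundary),
  exists l : \bar R, is_boundary_product o xi eta l.

Definition boundary_product (o : Y) (xi eta : boundary) : \bar R :=
  xget 0%E [set l | is_boundary_product o xi eta l].

Definition boundary_dist (o : Y) (xi eta : boundary) : \bar R :=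
  expeR (- boundary_product o xi eta).

Definition boundary_open (U : set boundary) := forall (o : Y) (xi : boundary),
  U xi -> exists2 r : R, 0 < r &
    [set eta | (boundary_dist o xi eta < r%:E)%E] `<=` U.

Definition induced_structure : set (boundary -> boundary -> \bar R) :=
  [set d | is_semimetric d /\ exists o : Y, moebius_equiv (boundary_dist o) d].

End Hyperbolic.
Arguments boundary {R} Y.

(* Main.v *)
Require Import Defs.
From HB Require Import structures.
From mathcomp Require Import all_boot all_order all_algebra.
From mathcomp Require Import all_classical all_reals all_analysis.
From mathcomp Require Import ring lra.
Import Order.TTheory GRing.Theory Num.Theory.
Import numFieldNormedType.Exports.
Set Implicit Arguments.
Unset Strict Implicit.
Unset Printing Implicit Defensive.
Local Open Scope classical_set_scope.
Local Open Scope ring_scope.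

(* Up to rescaling d(x,y) to s(x) s(y) d(x,y), the structure contains a finite
   continuous kernel k vanishing exactly on the diagonal, and k is Ptolemaic by
   (P).  Take for Y the tight span of "2 ln k": the functions F on the circle
   with F(x) + F(y) >= 2 ln k(x,y) for x != y that are minimal for this
   property, with the sup distance.
   - Y is proper because minimal functions in a ball are equicontinuous, and
     geodesic because a 1-Lipschitz retraction onto Y turns affine segments of
     dominating functions into geodesics.
   - The distance is d(F,G) = sup (2 ln k(x,y) - F(x) - G(y)), so the four-point
     inequality for ln k, which is Ptolemy's inequality up to ln 2, passes to Y.
   - A point x of the circle is the end of Y along which F tends to infinity
     away from x, and exp (-(x|y)_F) = k(x,y) exp (-(F(x) + F(y)) / 2), which is
     again a rescaling of k. *)

(** * Ptolemaic kernels on a compact space *)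

(** Two distinct points are required so that suprema over [y != x] range over non-empty sets. *)
Record ptolemaic (R : realType) (X : topologicalType) := Ptolemaic {
  ker :> X -> X -> R;
  ker_sym : forall x y, ker x y = ker y x;
  ker_diag : forall x, ker x x = 0;
  ker_pos : forall x y, x != y -> 0 < ker x y;
  ker_ptolemy : forall x y z u,
    ker x y * ker z u <= ker x z * ker y u + ker x u * ker y z;
  ker_continuous : continuous (fun p : X * X => ker p.1 p.2);
  ker_compact : compact [set: X];
  ker_nontrivial : exists a b : X, a != b }.

Section Kernel.
Context {R : realType} {X : topologicalType} (k : ptolemaic R X).
Implicit Types (x y z : X) (c e : R).

Lemma ker_ge0 x y : 0 <= k x y.
Proof. by have [->|/(ker_pos k)/ltW//] := eqVneq x y; rewrite ker_diag. Qed.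

Lemma ker_gt0_neq x y : 0 < k x y -> x != y.
Proof. by apply: contraTneq => ->; rewrite ker_diag ltxx. Qed.

Lemma ker_bounded : exists2 b : R, 0 < b & forall x y, k x y <= b.
Proof.
have cXX : compact [set: X * X].
  by rewrite -setXTT; apply: compact_setX; exact: (ker_compact k).
have : bounded_set ((fun p : X * X => k p.1 p.2) @` setT).
  apply: compact_bounded; apply: continuous_compact => //.
  exact/continuous_subspaceT/ker_continuous.
move=> [M [_ Mb]]; exists (`|M| + 1) => [|x y];
  first by rewrite (le_lt_trans (normr_ge0 M)) ?ltrDl.
have := Mb (`|M| + 1); rewrite (le_lt_trans (ler_norm M)) ?ltrDl// => /(_ isT).
by move=> /(_ (k x y)) /(_ (ex_intro2 _ _ (x, y) I erefl));
  apply: le_trans (ler_norm _).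
Qed.

(** Each [y] has a neighbourhood that works together with one of [x0]; compactness lets one
    neighbourhood of [x0] serve all [y]. *)
Lemma ker_equicontinuous x0 e : 0 < e ->
  \forall x \near x0, forall y, `|k x y - k x0 y| < e.
Proof.
move=> e0.
have /compact_near_coveringP /(_ X (nbhs x0)
  (fun x y => `|k x y - k x0 y| < e) _) cov := @ker_compact _ _ k.
suff: \forall x \near x0, [set: X] `<=` (fun y => `|k x y - k x0 y| < e).
  by apply: filterS => x h y; exact: h.
apply: cov => y _.
have e20 : 0 < e / 2 by rewrite divr_gt0.
have /= /cvgr_dist_lt /(_ _ e20) := @ker_continuous _ _ k (x0, y).
rewrite near_simpl => -[[A B] /= [A1 B1] AB].
exists (B, A) => //= -[y' x] /= [By Ax].
have h1 := AB (x, y') (conj Ax By).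
have h2 := AB (x0, y') (conj (nbhs_singleton A1) By).
rewrite /= in h1 h2.
have -> : k x y' - k x0 y' = (k x0 y - k x0 y') - (k x0 y - k x y') by ring.
by rewrite (le_lt_trans (ler_normB _ _))// (splitr e) ltrD.
Qed.

(** By compactness: [U] covers [x], and any other point has a neighbourhood on which [k x] stays
    above half its value there. *)
Lemma ker_sep1 x (U : set X) : nbhs x U ->
  exists2 c : R, 0 < c & forall z, ~ U z -> c <= k x z.
Proof.
move=> Ux.
have /compact_near_coveringP /(_ R 0^'+
  (fun c z => U z \/ c <= k x z) _) cov := @ker_compact _ _ k.
have : \forall c \near 0^'+, [set: X] `<=` (fun z => U z \/ c <= k x z).
  apply: cov => z _.
  have [->|zx] := eqVneq z x.
    by exists (U, setT) => [|[z' c] /= [? _]]; [split => //;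
      exact: filterT|left].
  have kp : 0 < k x z by apply: ker_pos; rewrite eq_sym.
  have kp2 : 0 < k x z / 2 by rewrite divr_gt0.
  have := ker_equicontinuous z kp2 => H.
  exists ([set z' | forall y, `|k z' y - k z y| < k x z / 2],
      [set c | c <= k x z / 2]).
    split => //=; exact: nbhs_right_le.
  move=> [z' c] /= [/(_ x) h hc]; right; move: h.
  rewrite (ker_sym k z') (ker_sym k z) ltr_distl => /andP[h _].
  lra.
move=> H; near (0:R)^'+ => c; exists c; first by near: c; exact: nbhs_right_gt.
move=> z nUz.
have /(_ z I)[] // : [set: X] `<=` (fun z => U z \/ c <= k x z) by near: c.
Unshelve. all: by end_near. Qed.

Lemma ker_sep x (U : set X) : nbhs x U ->
  exists2 c : R, 0 < c & \forall a \near x, forall z, ~ U z -> c <= k a z.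
Proof.
move=> /ker_sep1[c c0 H]; exists (c / 2); first by rewrite divr_gt0.
have c20 : 0 < c / 2 by rewrite divr_gt0.
apply: filterS (ker_equicontinuous x c20) => a h z /H cz.
by have := h z; rewrite ltr_distl => /andP[? _]; lra.
Qed.

(** Points near [a] stay away from [b], and all others stay away from [a]. Every point thus has a
    partner at which [logker] is bounded below. *)
Lemma ker_away : exists (a b : X) (c : R), 0 < c /\
  forall x, c <= k x a \/ c <= k x b.
Proof.
have [a [b ab]] := @ker_nontrivial _ _ k.
have kab := ker_pos k ab.
have h0 : 0 < k a b / 2 by rewrite divr_gt0.
have /ker_sep1[c c0 H] : nbhs a [set x | k a b / 2 <= k x b].
  apply: filterS (ker_equicontinuous a h0) => x /(_ b) /=.
  by rewrite ltr_distl => /andP[? _]; lra.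
exists a, b, (Num.min c (k a b / 2)); split; first by rewrite lt_min c0.
move=> x; have [h|/negP h] := boolP (k a b / 2 <= k x b).
  by right; rewrite ge_min h orbT.
by left; rewrite ge_min ker_sym H.
Qed.

Lemma neq_exists x : exists y, y != x.
Proof.
have [a [b ab]] := @ker_nontrivial _ _ k.
by have [xa|] := eqVneq a x; [exists b; rewrite -xa eq_sym|exists a].
Qed.

(* The factor 2 makes the Gromov products of the tight span equal to
   [- ln] of a kernel: they carry a factor 1/2 of their own. *)
Definition logker x y := 2 * ln (k x y).

Lemma logker_sym x y : logker x y = logker y x.
Proof. by rewrite /logker ker_sym. Qed.

Lemma ker_logker x y : x != y -> k x y = expR (logker x y / 2).
Proof. by move=> /(ker_pos k) kp; rewrite /logker mulrC mulKf// lnK. Qed.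

Lemma logker_ge x y c : x != y -> (c <= logker x y) = (expR (c / 2) <= k x y).
Proof. by move=> xy; rewrite (ker_logker xy) ler_expR ler_pM2r ?invr_gt0. Qed.

Lemma logker_ubound : exists b : R, forall x y, x != y -> logker x y <= b.
Proof.
have [b b0 kb] := ker_bounded; exists (2 * ln b) => x y xy.
by rewrite ler_pM2l// ler_ln// posrE ker_pos.
Qed.

(** A sum is at most twice its larger term, whence [ln 2]. The larger product is positive, so its
    pairs are distinct; this is recorded because [logker] is meaningful only off the diagonal. *)
Lemma logker_ptolemy x y z u : x != y -> z != u ->
  [/\ x != z, y != u &
    logker x y + logker z u <= logker x z + logker y u + 2 * ln 2] \/
  [/\ x != u, y != z &
    logker x y + logker z u <= logker x u + logker y z + 2 * ln 2].
Proof.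
have aux a b c d : 0 < a -> 0 < b -> 0 <= c -> 0 <= d -> a * b <= 2 * (c * d) ->
    [/\ 0 < c, 0 < d & 2 * ln a + 2 * ln b <= 2 * ln c + 2 * ln d + 2 * ln 2].
  move=> a0 b0 c0 d0 h.
  have ab0 : 0 < a * b by rewrite mulr_gt0.
  have cd0 : 0 < c * d by lra.
  have cp : 0 < c by rewrite lt_neqAle c0 andbT; apply: contraTneq cd0 => <-;
    rewrite mul0r ltxx.
  have dp : 0 < d by rewrite lt_neqAle d0 andbT; apply: contraTneq cd0 => <-;
    rewrite mulr0 ltxx.
  split => //.
  have : ln (a * b) <= ln (2 * (c * d)) by rewrite ler_ln// posrE; lra.
  rewrite !lnM ?posrE//; lra.
move=> xy zu; have := ker_ptolemy k x y z u.
have kxy := ker_pos k xy; have kzu := ker_pos k zu.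
have [le|le] := leP (k x z * k y u) (k x u * k y z) => h; [right|left].
- have [] := aux (k x y) (k z u) (k x u) (k y z) kxy kzu
    (ker_ge0 _ _) (ker_ge0 _ _).
    lra.
  by move=> /ker_gt0_neq -> /ker_gt0_neq ->.
- have [] := aux (k x y) (k z u) (k x z) (k y u) kxy kzu
    (ker_ge0 _ _) (ker_ge0 _ _).
    lra.
  by move=> /ker_gt0_neq -> /ker_gt0_neq ->.
Qed.

End Kernel.

(** * Tight functions *)

Section Tight.
Context {R : realType} {X : topologicalType} (k : ptolemaic R X).
Implicit Types (x y z : X) (F G : X -> R).

Definition dominating F := forall x y, x != y -> logker k x y <= F x + F y.

Definition tight F := dominating F /\
  forall x (e : R), 0 < e -> exists2 y, y != x & F x + F y < logker k x y + e.

Lemma dominating_lbound F : dominating F -> exists m : R, forall x, m <= F x.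
Proof.
move=> dF; have [a [b [c [c0 H]]]] := ker_away k.
have aux x y : c <= k x y -> 2 * ln c - F y <= F x.
  move=> ckxy; have xy : x != y by apply: (@ker_gt0_neq _ _ k); lra.
  rewrite lerBlDr (le_trans _ (dF _ _ xy))// ler_pM2l//.
  by rewrite ler_ln// posrE; lra.
exists (Num.min (2 * ln c - F a) (2 * ln c - F b)) => x.
by have [/aux h|/aux h] := H x; rewrite ge_min h ?orbT.
Qed.

(** For the upper bound, a nearly tight partner [y] gives [F x < b + 1 - F y], and [F y] is bounded
    below. *)
Lemma tight_bounded F : tight F -> exists M : R, forall x, `|F x| <= M.
Proof.
move=> [/dominating_lbound[m Fm] tF]; have [b kb] := logker_ubound k.
exists (`|m| + `|b| + 1) => x; have [y yx Fxy] := tF x 1 ltr01.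
have := kb x y; rewrite eq_sym yx => /(_ isT) h.
have := Fm x; have := Fm y; have := ler_norm b.
have := ler_norm (- m); have := normr_ge0 b; rewrite normrN.
by rewrite ler_norml => *; apply/andP; split; lra.
Qed.

(* A dominating [F] is tight iff it is its own dual; averaging with the dual
   halves the gap [F - dual F],
     and its iterates converge to a tight function. *)
Definition dual F x := sup [set logker k x y - F y | y in [set y | y != x]].

Lemma dual_le F r x : (forall y, y != x -> logker k x y - F y <= r) ->
  dual F x <= r.
Proof.
move=> H; apply: ge_sup => [|_ [y yx <-]]; last exact: H.
by have [y yx] := neq_exists k x; exists (logker k x y - F y), y.
Qed.

Lemma dual_ge F x y : dominating F -> y != x -> logker k x y - F y <= dual F x.
Proof.
move=> dF yx; apply: ub_le_sup; last by exists y.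
by exists (F x) => _ [z zx <-]; rewrite lerBlDr dF// eq_sym.
Qed.

Lemma dual_le_id F x : dominating F -> dual F x <= F x.
Proof. by move=> dF; apply: dual_le => y yx; rewrite lerBlDr dF// eq_sym. Qed.

Lemma le_dual F G x r : dominating F -> (forall y, F y <= G y + r) ->
  dual G x <= dual F x + r.
Proof.
move=> dF FG; apply: dual_le => y yx.
by have := dual_ge dF yx; have := FG y; lra.
Qed.

Lemma dominating_dual F x y : dominating F -> x != y ->
  logker k x y <= F x + dual F y.
Proof. by move=> dF xy; have := dual_ge dF xy; rewrite logker_sym; lra. Qed.

Lemma tightP F : tight F <-> dominating F /\ forall x, F x <= dual F x.
Proof.
split=> -[dF tF]; split=> // x.
- apply/ler_addgt0Pl => e e0; have [y yx] := tF x e e0.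
  by have := dual_ge dF yx; lra.
- move=> e e0; apply: contrapT => H; suff : dual F x <= F x - e.
    by have := tF x; lra.
  apply: dual_le => y yx; rewrite leNgt; apply/negP => h.
  by apply: H; exists y => //; lra.
Qed.

Definition tighten1 F x := (F x + dual F x) / 2.

(** [F] and [dual F] satisfy the mixed inequality in both orders, and these average to domination;
    [dual F] alone need not dominate. *)
Lemma tighten1_dominating F : dominating F -> dominating (tighten1 F).
Proof.
move=> dF x y xy; have := dominating_dual dF xy.
by have := @dominating_dual F y x dF;
  rewrite eq_sym xy logker_sym /tighten1 => /(_ isT); lra.
Qed.

Lemma tighten1_le F x : dominating F -> tighten1 F x <= F x.
Proof. by move=> dF; have := dual_le_id x dF; rewrite /tighten1; lra. Qed.

Definition tightenn n F := iter n tighten1 F.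

Lemma tightenn_dominating n F : dominating F -> dominating (tightenn n F).
Proof. by move=> dF; elim: n => //= n; exact: tighten1_dominating. Qed.

Lemma tightenn_le n F x : dominating F -> tightenn n.+1 F x <= tightenn n F x.
Proof. by move=> dF; apply/tighten1_le/tightenn_dominating. Qed.

Lemma tightenn_le0 n F x : dominating F -> tightenn n F x <= F x.
Proof. by move=> dF; elim: n => //= n /(le_trans (tightenn_le _ _ dF)). Qed.

Lemma tightenn_ge n F x : dominating F -> dual F x <= tightenn n F x.
Proof.
move=> dF; apply: (le_trans _ (dual_le_id x (tightenn_dominating n dF))).
rewrite -[leRHS]addr0; apply: le_dual; first exact: tightenn_dominating.
by move=> y; rewrite addr0; exact: tightenn_le0.
Qed.

(** The dual grows as the iterates decrease, so averaging an iterate with its dual at least halves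
    the gap. *)
Lemma tightenn_gap n F x : dominating F ->
  tightenn n F x - dual (tightenn n F) x <= (F x - dual F x) * 2^-1 ^+ n.
Proof.
move=> dF; elim: n x => [|n IH] x; first by rewrite expr0 mulr1.
have dn := tightenn_dominating n dF.
have : dual (tightenn n F) x <= dual (tightenn n.+1 F) x.
  rewrite -[leRHS]addr0; apply: le_dual; first exact: tightenn_dominating.
  by move=> y; rewrite addr0; exact: tightenn_le.
have := IH x; rewrite exprS [tightenn n.+1 F x]/= /tighten1 mulrCA.
rewrite -/(tightenn n F); set a := (_ * _ ^+ n); lra.
Qed.

Definition tighten F x := lim (tightenn n F x @[n --> \oo]).

Lemma tightenn_cvg F x : dominating F ->
  tightenn n F x @[n --> \oo] --> tighten F x.
Proof.
move=> dF; apply: (@nonincreasing_is_cvgn R (fun n => tightenn n F x)).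
  by apply/nonincreasing_seqP => n; exact: tightenn_le.
by exists (dual F x) => _ [n _ <-]; exact: tightenn_ge.
Qed.

Lemma tighten_le_tightenn n F x : dominating F -> tighten F x <= tightenn n F x.
Proof.
move=> dF; apply: (@nonincreasing_cvgn_ge R (fun n => tightenn n F x)).
  by apply/nonincreasing_seqP => m; exact: tightenn_le.
by apply/cvg_ex; exists (tighten F x); exact: tightenn_cvg.
Qed.

Lemma tighten_le F x : dominating F -> tighten F x <= F x.
Proof. exact: (@tighten_le_tightenn 0). Qed.

Lemma tighten_dominating F : dominating F -> dominating (tighten F).
Proof.
move=> dF x y xy.
apply: (@ler_cvg_to nat \oo _ R (fun=> logker k x y)
    (fun n => tightenn n F x + tightenn n F y)).
- exact: cvg_cst.
- by apply: cvgD; exact: tightenn_cvg.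
- by apply: nearW => n; exact: (tightenn_dominating n dF).
Qed.

Lemma tighten_tight F : dominating F -> tight (tighten F).
Proof.
move=> dF; apply/tightP; split=> [|x]; first exact: tighten_dominating.
rewrite -subr_le0.
have half : `|2^-1 : R| < 1 by rewrite ger0_norm ?invf_lt1 ?ltr1n.
apply: (@ler_cvg_to nat \oo _ R (fun=> tighten F x - dual (tighten F) x)
    (geometric (F x - dual F x) 2^-1)).
- exact: cvg_cst.
- exact: cvg_geometric.
apply: nearW => n.
apply: (le_trans _ (tightenn_gap n x dF)).
(* The limit lies below every iterate, so its dual lies above theirs. *)
apply: lerB; first exact: tighten_le_tightenn.
rewrite -[leRHS]addr0; apply: le_dual; first exact: tighten_dominating.
by move=> y; rewrite addr0; exact: tighten_le_tightenn.
Qed.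

Lemma tighten_id F : tight F -> tighten F = F.
Proof.
move=> /tightP[dF tF]; apply/funext => x.
have E n : tightenn n F = F.
  elim: n => //= n; rewrite -/(tightenn n F) => ->; apply/funext => y;
    rewrite /tighten1.
  by have := dual_le_id y dF; have := tF y; lra.
by rewrite /tighten; under eq_fun do rewrite E; exact: lim_cst.
Qed.

(** Both inequalities go through the induction together: [dual] reverses order, so each needs the
    other one step earlier. *)
Lemma tighten_lipschitz F G r : dominating F -> dominating G ->
  (forall x, F x <= G x + r) -> (forall x, G x <= F x + r) ->
  forall x, tighten F x <= tighten G x + r.
Proof.
move=> dF dG FG GF x.
have H n : (forall x, tightenn n F x <= tightenn n G x + r) /\
    (forall x, tightenn n G x <= tightenn n F x + r).
  elim: n => //= n [FGn GFn].
  have dFn := tightenn_dominating n dF; have dGn := tightenn_dominating n dG.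
  split=> y; rewrite -!/(tightenn n _) /tighten1.
    by have := le_dual y dGn GFn; have := FGn y; lra.
  by have := le_dual y dFn FGn; have := GFn y; lra.
apply: (@ler_cvg_to nat \oo _ R (fun n => tightenn n F x)
    (fun n => tightenn n G x + r)).
- exact: tightenn_cvg.
- by apply: cvgD; [exact: tightenn_cvg|exact: cvg_cst].
- by apply: nearW => n; exact: (H n).1.
Qed.

(** Boundedness keeps a nearly tight partner [y] of one point away from it, so [logker] at [y] moves
    little, and domination at the other point compares the values of [F]. *)
Lemma tight_equicontinuous x0 C e : 0 < e ->
  \forall x \near x0, forall F, tight F -> (forall z, `|F z| <= C) ->
    `|F x - F x0| < e.
Proof.
(* [c] bounds [k a y] below for a partner [y] tight up to [e / 2]. A change by less than [t * c]
   then costs at most a factor [expR (- (e / 4))], that is [e / 2] in [logker]. *)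
move=> e0; pose t := 1 - expR (- (e / 4)); pose c := expR (- (C + e / 4)).
have t0 : 0 < t by rewrite subr_gt0 expR_lt1; lra.
have tc0 : 0 < t * c by rewrite mulr_gt0// expR_gt0.
apply: filterS (ker_equicontinuous k x0 tc0) => x H F [dF tF] FC.
have aux a b : (forall y, `|k a y - k b y| < t * c) -> F a < F b + e.
  move=> ab; have e20 : 0 < e / 2 by lra.
  have [y ya Fy] := tF a _ e20.
  have ay : a != y by rewrite eq_sym.
  have Lay : - (2 * C) - e / 2 <= logker k a y.
    have := FC a; have := FC y; rewrite !ler_norml => /andP[? _] /andP[? _];
      lra.
  have kay : c <= k a y.
    move: Lay; rewrite logker_ge//; apply: le_trans.
    by rewrite /c ler_expR; lra.
  have kby : expR (- (e / 4)) * k a y <= k b y.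
    have := ab y; rewrite ltr_distl => /andP[_ h].
    have -> : expR (- (e / 4)) = 1 - t by rewrite /t; ring.
    have : t * c <= t * k a y by rewrite ler_pM2l.
    lra.
  have byn : b != y.
    apply: (@ker_gt0_neq _ _ k); apply: (lt_le_trans _ kby).
    by rewrite mulr_gt0 ?expR_gt0 ?ker_pos.
  have : logker k a y - e / 2 <= logker k b y.
    rewrite logker_ge//; apply: (le_trans _ kby).
    by rewrite (ker_logker k ay) -expRD ler_expR; lra.
  by have := dF b y byn; lra.
rewrite ltr_distl; apply/andP; split.
  by rewrite ltrBlDr; apply: aux => y; rewrite distrC.
exact: aux.
Qed.

End Tight.

(** * The tight span *)

Record tight_span (R : realType) (X : topologicalType) (k : ptolemaic R X) :=
  TightSpan { span_fun :> X -> R; span_tight : tight k span_fun }.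

Section SpanMetric.
Context {R : realType} {X : topologicalType} (k : ptolemaic R X).
Notation Y := (tight_span k).
Implicit Types (x y z : X) (F G H : Y).

Lemma span_eq F G : F =1 G -> F = G.
Proof.
case: F G => [f tf] [g tg] /= /funext fg; rewrite fg in tf *.
by congr TightSpan; exact: Prop_irrelevance.
Qed.

Lemma span_dominating F : dominating k F.
Proof. by case: F => f []. Qed.

HB.instance Definition _ := gen_eqMixin Y.
HB.instance Definition _ := gen_choiceMixin Y.

Definition span_dist F G := sup (range (fun x => `|F x - G x|)).

Lemma le_span_dist F G x : `|F x - G x| <= span_dist F G.
Proof.
have [M FM] := tight_bounded (span_tight F).
have [N GN] := tight_bounded (span_tight G).
apply: ub_le_sup; last by exists x.
by exists (M + N) => _ [z _ <-]; rewrite (le_trans (ler_normB _ _))// lerD.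
Qed.

Lemma span_dist_le_abs F G r : (forall x, `|F x - G x| <= r) ->
  span_dist F G <= r.
Proof.
have [a _] := ker_nontrivial k => FG.
by apply: ge_sup => [|_ [x _ <-]//]; exists `|F a - G a|, a.
Qed.

Let span_distxx F : span_dist F F = 0.
Proof.
have [a _] := ker_nontrivial k.
apply/eqP; rewrite eq_le (le_trans _ (le_span_dist F F a)) ?normr_ge0// andbT.
by apply: span_dist_le_abs => x; rewrite subrr normr0.
Qed.

Let span_dist_eq0 F G : span_dist F G = 0 -> F = G.
Proof.
move=> FG0; apply: span_eq => x; have := le_span_dist F G x.
by rewrite FG0 normr_le0 subr_eq0 => /eqP.
Qed.

Let span_dist_sym F G : span_dist F G = span_dist G F.
Proof. by congr sup; congr image; apply/funext => x; rewrite distrC. Qed.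

Let span_dist_triangle G F H : span_dist F H <= span_dist F G + span_dist G H.
Proof.
apply: span_dist_le_abs => x.
have -> : F x - H x = (F x - G x) + (G x - H x) by ring.
by rewrite (le_trans (ler_normD _ _))// lerD// le_span_dist.
Qed.

HB.instance Definition _ := isMetric.Build R Y span_distxx span_dist_eq0
  span_dist_sym span_dist_triangle.

Lemma le_mdist_abs F G x : `|F x - G x| <= mdist F G.
Proof. exact: le_span_dist. Qed.

Lemma le_mdist F G x : F x - G x <= mdist F G.
Proof. exact: le_trans (ler_norm _) (le_mdist_abs _ _ _). Qed.

Lemma mdist_le_abs F G r : (forall x, `|F x - G x| <= r) -> mdist F G <= r.
Proof. exact: span_dist_le_abs. Qed.

Lemma logker_le_mdist F G x y : x != y -> logker k x y - F x - G y <= mdist F G.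
Proof.
move=> xy; have := span_dominating F xy; have := le_mdist F G y; lra.
Qed.

(* By tightness, [mdist F G] is the supremum of [logker x y - F x - G y]. *)
Lemma mdist_le F G r :
  (forall x y, x != y -> logker k x y - F x - G y <= r) -> mdist F G <= r.
Proof.
move=> FG; have [dF tF] := span_tight F; have [dG tG] := span_tight G.
apply: mdist_le_abs => x; rewrite ler_distl.
apply/andP; split; rewrite ?lerBlDr; apply/ler_addgt0Pl => e e0.
- have [y yx] := tG x e e0; have xy : x != y by rewrite eq_sym.
  have := FG x y xy; lra.
- have [y yx] := tF x e e0.
  have := FG y x yx; have := logker_sym k x y; lra.
Qed.

Lemma mdist_approx F G e : 0 < e ->
  exists x y, x != y /\ mdist F G - e < logker k x y - F x - G y.
Proof.
move=> e0; apply: contrapT => H; suff : mdist F G <= mdist F G - e by lra.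
apply: mdist_le => x y xy; rewrite leNgt; apply/negP => h.
by apply: H; exists x, y.
Qed.

(** Domination by [F] turns a nearly optimal pair into a single point, so the one-sided supremum of
    [F - G] already gives the distance. *)
Lemma mdist_approx_diff F G e : 0 < e -> exists x, mdist F G - e < F x - G x.
Proof.
move=> e0; have [x [y [xy h]]] := mdist_approx G F e0.
exists x; have := span_dominating F xy.
rewrite (metric_sym F); move: h; lra.
Qed.

End SpanMetric.

(** * Properness, hyperbolicity and geodesics of the tight span *)

Section SpanGeometry.
Context {R : realType} {X : topologicalType} (k : ptolemaic R X).
Notation Y := (tight_span k).
Implicit Types (x y z : X) (F G H : Y).

Lemma tight_uniform_limit (p : X -> R) :
  (forall e, 0 < e -> exists G : Y, forall x, `|G x - p x| <= e) -> tight k p.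
Proof.
move=> H; split=> [x y xy|x e e0].
  apply/ler_addgt0Pl => e e0; have e20 : 0 < e / 2 by lra.
  have [G Gp] := H _ e20; have := span_dominating G xy.
  have := Gp x; have := Gp y; rewrite !ler_distl => /andP[_ ?] /andP[_ ?]; lra.
have e40 : 0 < e / 4 by lra.
have [G Gp] := H _ e40; have [y yx] := (span_tight G).2 x _ e40.
exists y => //.
have := Gp x; have := Gp y; rewrite !ler_distl => /andP[? _] /andP[? _]; lra.
Qed.

(** Arzelà-Ascoli with ultrafilters: bounded values give a pointwise limit, equicontinuity makes the
    convergence uniform, and a uniform limit of tight functions is tight. *)
Lemma tight_span_proper : metric_proper Y.
Proof.
move=> F0 r; rewrite compact_ultra => F FU FB.
have [M FM] := tight_bounded (span_tight F0); pose C := M + r.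
have BC G : mdist F0 G <= r -> forall x, `|G x| <= C.
  move=> F0G x; have := FM x; have := le_mdist_abs F0 G x.
  rewrite distrC => h1 h2; have -> : G x = (G x - F0 x) + F0 x by ring.
  by rewrite (le_trans (ler_normD _ _))// /C; lra.
have /choice[p cvg_p] x : exists y : R, (fun G : Y => G x) @ F --> y.
  have FC : ((fun G : Y => G x) @ F) `[- C, C]%classic.
    by apply: (@filterS Y F _ _ _ _ FB) => G /BC/(_ x);
      rewrite /= in_itv/= ler_norml.
  have [y [_ cly]] := @segment_compact R (- C) C _ _ FC; exists y => B yB.
  have [//|FnB] := in_ultra_setVsetC ((fun G : Y => G x) @^-1` B) FU.
  by have [z []] := cly (~` B) B FnB yB.
have unif (e : R) : 0 < e ->
    \forall G \near F, forall x, `|(G : Y) x - p x| < e.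
  move=> e0; have e30 : 0 < e / 3 by lra.
  suff : \forall G \near F, [set: X] `<=` (fun x => `|(G : Y) x - p x| < e).
    by apply: filterS => G h x; exact: h.
  have /compact_near_coveringP /(_ Y F (fun (G : Y) x => `|G x - p x| < e) _) :=
    @ker_compact _ _ k; apply => x0 _.
  (* The pointwise limit inherits the modulus of equicontinuity, with a non-strict bound. *)
  have px : \forall x \near x0, `|p x - p x0| <= e / 3.
    apply: filterS (tight_equicontinuous k x0 C e30) => x equi.
    apply: (@ler_cvg_to Y F _ R (fun G : Y => `|G x - G x0|) (fun=> e / 3)).
    - by apply: cvg_norm; apply: cvgB; exact: cvg_p.
    - exact: cvg_cst.
    - by apply: filterS FB => G /BC GC; apply/ltW/equi => //; exact: span_tight.
  exists ([set x | `|p x - p x0| <= e / 3 /\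
      forall f, tight k f -> (forall z, `|f z| <= C) -> `|f x - f x0| < e / 3],
    [set G : Y | mdist F0 G <= r /\ `|p x0 - G x0| < e / 3]).
    split => /=.
      by apply: filterI => //; exact: tight_equicontinuous.
    apply: filterI => //.
    by have /cvgr_dist_lt /(_ _ e30) := cvg_p x0.
  move=> [x G] /= [[h1 h2] [/BC GC h3]].
  have h4 := h2 G (span_tight G) GC.
  have -> : G x - p x = (G x - G x0) - (p x0 - G x0) - (p x - p x0) by ring.
  rewrite (le_lt_trans (ler_normB _ _))//.
  have := ler_normB (G x - G x0) (p x0 - G x0); lra.
have tp : tight k p.
  apply: tight_uniform_limit => e /unif /filter_ex[G Gp].
  by exists G => x; exact/ltW.
pose P := TightSpan tp; have FP : F --> P.
  apply/metricType_numDomainType.fcvgrPdist_lt => e e0.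
  have e20 : 0 < e / 2 by lra.
  apply: filterS (unif _ e20) => G Gp.
  rewrite (@le_lt_trans _ _ (e / 2))//; last by lra.
  by apply: mdist_le_abs => x; rewrite distrC; exact/ltW.
exists P; split => //=.
apply/ler_addgt0Pl => e e0.
have /metricType_numDomainType.fcvgrPdist_lt /(_ _ e0) FPe := FP.
have [G [/= h1 h2]] := filter_ex (filterI FB FPe).
by have := metric_triangle F0 G P; rewrite (metric_sym G); lra.
Qed.

(** Pairs nearly optimal for [F, G] and for [H, K] are regrouped by Ptolemy's inequality, and each
    regrouped pair bounds a distance from below. *)
Lemma tight_span_hyperbolic : gromov_hyperbolic Y.
Proof.
have four (F G H K : Y) e : 0 < e ->
    mdist F G + mdist H K <= mdist F H + mdist G K + 2 * ln 2 + e \/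
    mdist F G + mdist H K <= mdist F K + mdist G H + 2 * ln 2 + e.
  move=> e0; have e20 : 0 < e / 2 by lra.
  have [x [y [xy FG]]] := mdist_approx F G e20.
  have [z [u [zu HK]]] := mdist_approx H K e20.
  have [[xz yu h]|[xu yz h]] := logker_ptolemy k xy zu; [left|right].
    by have := logker_le_mdist F H xz; have := logker_le_mdist G K yu; lra.
  by have := logker_le_mdist F K xu; have := logker_le_mdist G H yz; lra.
exists (ln 2 : R) => o x y z; rewrite lerBlDr; apply/ler_addgt0Pl => e e0.
rewrite /gromov_product ge_min.
have [h|h] := four x z y o e e0; apply/orP; [left|right].
  by lra.
by rewrite (metric_sym y z); lra.
Qed.

Definition segment_fun F G t x := (1 - t) * F x + t * G x.

Lemma segment_dominating F G t : 0 <= t <= 1 ->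
  dominating k (segment_fun F G t).
Proof.
move=> /andP[t0 t1] x y xy.
have := span_dominating F xy; have := span_dominating G xy => hG hF.
have t1' : 0 <= 1 - t by lra.
by have := ler_wpM2l t0 hG; have := ler_wpM2l t1' hF; rewrite /segment_fun; lra.
Qed.

(** [F] is only the default when [f] is not tight; it makes curves total on [R], as [geodesic]
    asks. *)
Definition to_span (f : X -> R) (F : Y) : Y :=
  xget F [set G : Y | G = f :> (X -> R)].

Lemma to_spanE f F : tight k f -> to_span f F = f :> (X -> R).
Proof. by move=> tf; apply: (@xgetPex _ F [set G : Y | G = f :> (X -> R)]);
  exists (TightSpan tf). Qed.

(** The tightened segment is 1-Lipschitz and joins two points at distance [D] over a parameter
    interval of length [D], so no distance along it can shrink. *)
Lemma tight_span_geodesic : geodesic Y.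
Proof.
move=> F G; set D := mdist F G.
have [D0|D0] := eqVneq D 0.
  have FG : F = G by exact: mdist_positivity.
  exists (fun=> F); split => // s t;
    rewrite D0 !in_itv/= -!eq_le => /eqP <- /eqP <-.
  by rewrite mdistxx subrr normr0.
have Dp : 0 < D by rewrite lt_neqAle eq_sym D0 mdist_ge0.
pose g t := to_span (tighten k (segment_fun F G (t / D))) F.
have gE t : 0 <= t <= D ->
    g t = tighten k (segment_fun F G (t / D)) :> (X -> R) /\
    dominating k (segment_fun F G (t / D)).
  move=> /andP[t0 tD]; have dom : dominating k (segment_fun F G (t / D)).
    by apply: segment_dominating;
      rewrite divr_ge0 ?(ltW Dp)//= ler_pdivrMr// mul1r.
  by split=> //; apply/to_spanE/tighten_tight.
have lip s t : 0 <= s <= D -> 0 <= t <= D -> mdist (g s) (g t) <= `|s - t|.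
  have aux a b x :
      segment_fun F G (a / D) x <= segment_fun F G (b / D) x + `|a - b|.
    have -> : segment_fun F G (a / D) x =
        segment_fun F G (b / D) x + (a - b) / D * (G x - F x).
      by rewrite /segment_fun; field.
    rewrite lerD2l (le_trans (ler_norm _))// !normrM normfV (gtr0_norm Dp).
    by rewrite -mulrA ler_piMr// mulrC ler_pdivrMr// mul1r distrC le_mdist_abs.
  move=> /gE[gs ds] /gE[gt dt]; apply: mdist_le_abs => x.
  rewrite gs gt ler_distl lerBlDr.
  by rewrite !tighten_lipschitz// => y; rewrite // distrC.
have g0 : g 0 = F.
  apply: span_eq => x; rewrite (gE 0 _).1 ?lexx ?ltW// mul0r.
  have -> : segment_fun F G 0 = F.
    by apply/funext => y; rewrite /segment_fun; ring.
  by rewrite tighten_id//; exact: span_tight.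
have gD : g D = G.
  apply: span_eq => x; rewrite (gE D _).1 ?lexx ?ltW// divff//.
  have -> : segment_fun F G 1 = G.
    by apply/funext => y; rewrite /segment_fun; ring.
  by rewrite tighten_id//; exact: span_tight.
exists g; split => // s t; rewrite !in_itv/= => hs ht.
have hD0 : 0 <= (0 : R) <= D by rewrite lexx ltW.
have hDD : 0 <= D <= D by rewrite lexx ltW.
wlog st : s t hs ht / s <= t.
  by move=> W; have [/ltW ?|?] := ltP t s; [rewrite metric_sym distrC|];
    apply: W.
apply/eqP; rewrite eq_le lip//=.
have := metric_triangle F (g s) G; have := metric_triangle (g s) (g t) G.
have := lip 0 s hD0 hs; have := lip t D ht hDD; rewrite g0 gD.
case/andP: hs => s0 sD; case/andP: ht => t0 tD.
rewrite sub0r normrN (ger0_norm s0) (distrC t) (distrC s).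
by rewrite !ger0_norm ?subr_ge0//; rewrite -/D; lra.
Qed.

End SpanGeometry.

(** A Cauchy filter contains a closed ball, which is compact, and converges to its cluster point
    there. *)
Lemma proper_complete (R : realType) (Y : metricType R) :
  metric_proper Y -> metric_complete Y.
Proof.
move=> properY F PF /cauchyP cF.
have [x Fx] := cF 1 ltr01; rewrite ballEmdist in Fx.
have FB : F [set y | mdist x y <= 1] by apply: filterS Fx => y /ltW.
have [p [_ clp]] := properY x 1 F PF FB.
exists p; apply/metricType_numDomainType.fcvgrPdist_lt => e e0.
have e30 : 0 < e / 3 by lra.
have [y Fy] := cF _ e30.
have [z [yz pz]] := clp _ _ Fy (nbhsx_ballx p _ e30).
apply: filterS Fy => w; move: yz pz; rewrite !ballEmdist /= => yz pz yw.
have := metric_triangle p z w; have := metric_triangle z y w.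
by rewrite (metric_sym z y); lra.
Qed.

(** * The boundary of the tight span *)

Section SpanBoundary.
Context {R : realType} {X : topologicalType} (k : ptolemaic R X).
Notation Y := (tight_span k).
Implicit Types (x y z : X) (o F G : Y) (u v : nat -> Y).

Lemma span_continuous o : continuous o.
Proof.
move=> x; apply/cvgrPdist_lt => e e0;
  have [M oM] := tight_bounded (span_tight o).
apply: filterS (tight_equicontinuous k x M e0) => y.
by rewrite distrC; apply => //; exact: span_tight.
Qed.

(* [boundary_ker o x y] is [exp (- (x|y)_o)]. *)
Definition boundary_ker o x y : R := k x y * expR (- ((o x + o y) / 2)).

Lemma boundary_kerxx o x : boundary_ker o x x = 0.
Proof. by rewrite /boundary_ker ker_diag mul0r. Qed.

Lemma boundary_kerE o x y : x != y ->
  boundary_ker o x y = expR (- ((o x + o y - logker k x y) / 2)).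
Proof. by move=> /(ker_logker k) xy; rewrite /boundary_ker xy -expRD;
  congr expR; field. Qed.

Lemma boundary_ker_continuous o :
  continuous (fun p : X * X => boundary_ker o p.1 p.2).
Proof.
move=> p; apply: cvgM; first exact: (@ker_continuous _ _ k p).
apply: (@continuous_comp _ _ _ (fun p : X * X => - ((o p.1 + o p.2) / 2)) expR);
  last exact: continuous_expR.
apply: cvgN; apply: cvgMl; apply: cvgD.
  by apply: (@continuous_comp _ _ _ fst o);
    [exact: cvg_fst|exact: span_continuous].
by apply: (@continuous_comp _ _ _ snd o);
  [exact: cvg_snd|exact: span_continuous].
Qed.

Lemma boundary_ker_sep o x (U : set X) : nbhs x U ->
  exists2 c : R, 0 < c & forall z, ~ U z -> c <= boundary_ker o x z.
Proof.
move=> /(ker_sep1 k)[c c0 H]; have [M oM] := tight_bounded (span_tight o).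
exists (c * expR (- M)); first by rewrite mulr_gt0// expR_gt0.
move=> z /H cz; apply: ler_pM => //; rewrite ?expR_ge0// ?(ltW c0)//.
rewrite ler_expR; have := oM x; have := oM z.
by rewrite !ler_norml => /andP[_ ?] /andP[_ ?]; lra.
Qed.

(* The trace on the tight span of the neighbourhoods of the point at infinity
   [x]: a function is close to [x] when it is large away from [x]. *)
Definition end_nbhs x : set_system Y := [set W | exists2 U, nbhs x U &
  exists A : R, forall F : Y, (forall z, ~ U z -> A <= F z) -> W F].

Global Instance end_nbhs_filter x : Filter (end_nbhs x).
Proof.
split; first by exists setT; [exact: filterT|exists 0].
- move=> V W [U1 xU1 [A1 h1]] [U2 xU2 [A2 h2]].
  exists (U1 `&` U2); first exact: filterI.
  exists (Num.max A1 A2) => F FA.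
  split; [apply: h1|apply: h2] => z nU.
    by have := FA z; rewrite ge_max => /(_ _)/andP[]// [].
  by have := FA z; rewrite ge_max => /(_ _)/andP[]// [].
- by move=> V W VW [U xU [A h]]; exists U => //; exists A => F /h/VW.
Qed.

(** [mdist F G] is a supremum over pairs [p], [q]. For [p] in [U] and [q] in [V] the kernel bound
    applies; otherwise [F p] or [G q] is large, and domination by [o] suffices. *)
Lemma gromov_product_ge o x y (A : R) : boundary_ker o x y < expR (- A) ->
  \forall F \near end_nbhs x & G \near end_nbhs y, A <= gromov_product o F G.
Proof.
move=> xyA; have [M oM] := tight_bounded (span_tight o).
have := cvgr_lt _ (@boundary_ker_continuous o (x, y)) _ xyA.
move=> -[[U V] /= [xU yV] UV].
have far W p : forall F, (forall z, ~ W z -> 2 * A + M <= F z) -> ~ W p ->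
    o p - F p <= mdist o F - 2 * A.
  move=> F FW Wp; have := FW p Wp; have := oM p; have := mdist_ge0 o F.
  by rewrite ler_norml => ? /andP[_ ?] ?; lra.
exists ([set F : Y | forall z, ~ U z -> 2 * A + M <= F z],
        [set G : Y | forall z, ~ V z -> 2 * A + M <= G z]).
  by split; [exists U|exists V] => //; exists (2 * A + M).
move=> [F G] /= [FU GV]; rewrite /gromov_product !(metric_sym _ o).
suff : mdist F G <= mdist o F + mdist o G - 2 * A by lra.
apply: mdist_le => p q pq; have := span_dominating o pq.
have := le_mdist o F p; have := le_mdist o G q => h1 h2 h3.
have [pU|/(far _ _ _ FU) ?] := pselect (U p); last by lra.
have [qV|/(far _ _ _ GV) ?] := pselect (V q); last by lra.
have := UV (p, q) (conj pU qV); rewrite /= boundary_kerE// ltr_expR; lra.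
Qed.

(** Points [a] in [U] and [b] in [V] nearly attaining [mdist o F] and [mdist o G] form a pair that
    bounds [mdist F G] from below. *)
Lemma gromov_product_le o x y (A : R) : expR (- A) < boundary_ker o x y ->
  \forall F \near end_nbhs x & G \near end_nbhs y, gromov_product o F G <= A.
Proof.
move=> xyA; have [M oM] := tight_bounded (span_tight o).
have := cvgr_gt _ (@boundary_ker_continuous o (x, y)) _ xyA.
move=> -[[U V] /= [xU yV] UV].
have disj p : U p -> V p -> False.
  move=> Up Vp; have := UV (p, p) (conj Up Vp).
  by rewrite /= boundary_kerxx ltNge expR_ge0.
(* Outside [W], [o - F] is at most [-1], while [w] shows that the distance is at least 1; with error
   at most 1, a near-maximum lies in [W]. *)
have near_max W w e F : ~ W w -> (forall z, ~ W z -> M + 1 <= F z) ->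
    0 < e -> e <= 1 -> exists2 a, W a & mdist o F - e < o a - F a.
  move=> Ww FW e0 e1; have [a oFa] := mdist_approx_diff o F e0.
  exists a => //; apply: contrapT => Wa.
  have := FW a Wa; have := FW w Ww; have := le_mdist F o w.
  have := oM a; have := oM w;
    rewrite !ler_norml (metric_sym F) => /andP[_ ?] /andP[_ ?].
  by lra.
exists ([set F : Y | forall z, ~ U z -> M + 1 <= F z],
        [set G : Y | forall z, ~ V z -> M + 1 <= G z]).
  by split; [exists U|exists V] => //; exists (M + 1).
move=> [F G] /= [FU GV]; rewrite /gromov_product !(metric_sym _ o).
apply/ler_addgt0Pl => e e0; pose d := Num.min e 1.
have d0 : 0 < d by rewrite lt_min e0 ltr01.
have d1 : d <= 1 by rewrite ge_min lexx orbT.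
have de : d <= e by rewrite ge_min lexx.
have nUy : ~ U y by move=> Uy; exact: (disj y Uy (nbhs_singleton yV)).
have nVx : ~ V x by move=> Vx; exact: (disj x (nbhs_singleton xU) Vx).
have [a Ua oFa] := near_max U y d F nUy FU d0 d1.
have [b Vb oGb] := near_max V x d G nVx GV d0 d1.
have ab : a != b by apply/eqP => ab; apply: (disj a) => //; rewrite ab.
have := UV (a, b) (conj Ua Vb); rewrite /= boundary_kerE// ltr_expR.
by have := logker_le_mdist F G ab; lra.
Qed.

(** This is [- ln (boundary_ker o x y)], by cases so that the diagonal gives [+oo]. *)
Definition end_product o x y : \bar R :=
  if x == y then +oo%E else ((o x + o y - logker k x y) / 2)%:E.

Lemma gromov_product_cvg o x y u v : u @ \oo --> end_nbhs x ->
  v @ \oo --> end_nbhs y ->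
  (gromov_product o (u i) (v i))%:E @[i --> \oo] --> end_product o x y.
Proof.
move=> ux vy.
have ge A : boundary_ker o x y < expR (- A) ->
    \forall i \near \oo, A <= gromov_product o (u i) (v i).
  move=> /gromov_product_ge[[P Q] /= [xP yQ] PQ].
  have uP : \forall i \near \oo, P (u i) by exact: ux.
  have vQ : \forall i \near \oo, Q (v i) by exact: vy.
  by apply: filterS2 uP vQ => i Pi Qi; exact: (PQ (u i, v i)).
have le A : expR (- A) < boundary_ker o x y ->
    \forall i \near \oo, gromov_product o (u i) (v i) <= A.
  move=> /gromov_product_le[[P Q] /= [xP yQ] PQ].
  have uP : \forall i \near \oo, P (u i) by exact: ux.
  have vQ : \forall i \near \oo, Q (v i) by exact: vy.
  by apply: filterS2 uP vQ => i Pi Qi; exact: (PQ (u i, v i)).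
rewrite /end_product; have [xy|xy] := eqVneq x y.
  apply/cvgeryP/cvgryPge => A; apply: ge.
  by rewrite xy boundary_kerxx expR_gt0.
apply: cvg_EFin; first exact: nearW.
apply/cvgrPdist_le => e e0.
rewrite boundary_kerE// in ge le.
set l := (_ / 2) in ge le *.
have h1 := ge (l - e); have h2 := le (l + e).
rewrite !ltr_expR in h1 h2.
have {}h1 := h1 ltac:(lra); have {}h2 := h2 ltac:(lra).
apply: filterS2 h1 h2 => i ? ?; rewrite /= ler_distl; apply/andP; split; lra.
Qed.

(** * Boundary points as points of the base space *)

Lemma tight_span_inhabited : exists F : Y, True.
Proof.
have [b kb] := logker_ubound k.
have d : dominating k (fun=> b / 2) by move=> x y /kb; lra.
by exists (TightSpan (tighten_tight d)).
Qed.

Lemma end_converges_to_infinity u x : u @ \oo --> end_nbhs x ->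
  converges_to_infinity u.
Proof.
move=> ux o A.
have : boundary_ker o x x < expR (- A) by rewrite boundary_kerxx expR_gt0.
move=> /gromov_product_ge[[P Q] /= [xP xQ] PQ].
exists (u @^-1` P, u @^-1` Q) => /=; first by split; exact: ux.
by move=> [i j] /= [Pi Qj]; exact: (PQ (u i, u j)).
Qed.

Lemma end_unique o u v x y : u @ \oo --> end_nbhs x ->
  v @ \oo --> end_nbhs y ->
  gromov_product o (u i) (v i) @[i --> \oo] --> +oo -> x = y.
Proof.
move=> ux vy uv; apply: contrapT => /eqP xy.
have /cvgeryP h1 := uv; have h2 := @gromov_product_cvg o _ _ _ _ ux vy.
have := cvg_unique (@ereal_hausdorff R) h1 h2.
by rewrite /end_product (negbTE xy) => /(_ _).
Qed.

(** The end is the limit of points [a i] where [o - u i] is nearly maximal. Large Gromov products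
    make [k (a i) (a j)] small, and domination at [a i] makes [u i] large away from it. *)
Lemma end_exists u : converges_to_infinity u ->
  exists x, u @ \oo --> end_nbhs x.
Proof.
move=> cu; pose o := u 0%N; have [M oM] := tight_bounded (span_tight o).
have /choice[a ua] i : exists x, mdist o (u i) - 1 < o x - u i x.
  exact: mdist_approx_diff.
have oMa x : o x <= M by have := oM x; rewrite ler_norml => /andP[].
(* For each of [i] and [j] the near-maximum costs 1 and the bound on [o] costs [M]; half the total
   is [1 + M]. *)
have kaa (e : R) : 0 < e -> \forall i & j \near \oo, k (a i) (a j) <= e.
  move=> e0; apply: filterS (cu o (1 + M - ln e)) => -[i j] /=.
  rewrite /gromov_product !(metric_sym _ o) => h.
  have [->|aij] := eqVneq (a i) (a j); first by rewrite ker_diag ltW.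
  have h1 := logker_le_mdist (u i) (u j) aij.
  rewrite (ker_logker k aij) -[leRHS]lnK// ler_expR.
  have := ua i; have := ua j; have := oMa (a i); have := oMa (a j); lra.
have [x [_ clx]] : [set: X] `&` cluster (a @ \oo) !=set0.
  by apply: (ker_compact k); exact: filterT.
(* Being Cauchy for [k], the sequence converges to its cluster point: an [a i] with [c <= k x (a i)]
   would be too far from some [a j] near [x]. *)
have ax : a @ \oo --> x.
  move=> U /(ker_sep1 k)[c c0 sep]; have c40 : 0 < c / 4 by lra.
  have [[P Q] /= [PN QN] PQ] := kaa _ c40.
  apply: filterS PN => i Pi; apply: contrapT => /sep cxai.
  have aQ : (a @ \oo) (a @` Q) by apply: filterS QN => j Qj; exists j.
  have [z [[j Qj <-] /(_ (a i))]] := clx _ _ aQ (ker_equicontinuous k x c40).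
  rewrite ltr_distl => /andP[h1 h2]; have := PQ (i, j) (conj Pi Qj).
  by rewrite /= ker_sym; lra.
exists x => W [U /(ker_sep k)[c c0 sep] [A HA]].
have Dinf := cu o (A + M + 1 - 2 * ln c).
have {}Dinf : \forall i \near \oo, A + M + 1 - 2 * ln c <= mdist o (u i).
  move: Dinf => [[P Q] /= [PN QN] PQ].
  apply: filterS2 PN QN => i Pi Qi.
  by have := PQ (i, i) (conj Pi Qi);
    rewrite /= /gromov_product mdistxx (metric_sym o); lra.
apply: filterS2 Dinf (ax _ sep) => i Di si; apply: HA => z /si caz.
have az : a i != z by apply: (@ker_gt0_neq _ _ k); lra.
have := span_dominating (u i) az; have := ua i; have := oMa (a i).
have : 2 * ln c <= logker k (a i) z by rewrite ler_pM2l// ler_ln// posrE; lra.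
lra.
Qed.

(** Lowering [o] by [n] at [x] and raising it by [n] elsewhere keeps it dominating. Tightening keeps
    the value at [x] low, and domination then forces large values away from [x]. *)
Lemma end_inhabited x : exists u, u @ \oo --> end_nbhs x.
Proof.
case: tight_span_inhabited => o _.
pose f (n : nat) z : R := if z == x then o x - n%:R else o z + n%:R.
have df n : dominating k (f n).
  move=> y z yz; have := span_dominating o yz; rewrite /f.
  have : (0 : R) <= n%:R by [].
  have [yx|_] := eqVneq y x; have [zx|_] := eqVneq z x; rewrite ?yx ?zx;
    try lra.
  by rewrite yx zx eqxx in yz.
exists (fun n => TightSpan (tighten_tight (df n))) => W.
move=> [U /(ker_sep1 k)[c c0 sep] [A HA]].
have big : \forall n \near \oo, A + o x - 2 * ln c <= n%:R.
  exact: nbhs_infty_ger.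
apply: (filterS _ big) => n hn /=; apply: HA => z /sep cxz /=.
have xz : x != z by apply: (@ker_gt0_neq _ _ k); lra.
have := tighten_dominating (df n) xz; have := tighten_le x (df n).
rewrite {2}/f eqxx.
have : 2 * ln c <= logker k x z by rewrite ler_pM2l// ler_ln// posrE; lra.
lra.
Qed.

Lemma gromov_equivalent_end u v x : u @ \oo --> end_nbhs x ->
  v @ \oo --> end_nbhs x -> gromov_equivalent u v.
Proof.
move=> ux vx o; apply/cvgeryP.
by have := @gromov_product_cvg o _ _ _ _ ux vx; rewrite /end_product eqxx.
Qed.

Lemma boundary_endP (xi : boundary Y) :
  exists x, set_val xi = [set u | u @ \oo --> end_nbhs x].
Proof.
have [u cu xiE] : boundary Y (set_val xi) by exact: set_valP.
have [x ux] := end_exists cu; exists x; rewrite xiE.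
apply/seteqP; split=> v /=.
  move=> [cv uv]; have [y vy] := end_exists cv.
  by case: tight_span_inhabited => o _; rewrite (end_unique ux vy (uv o)).
by move=> vx; split; [exact: end_converges_to_infinity vx|exact:
  gromov_equivalent_end vx].
Qed.

Definition boundary_end (xi : boundary Y) : X :=
  projT1 (cid (boundary_endP xi)).

Lemma boundary_endE xi :
  set_val xi = [set u | u @ \oo --> end_nbhs (boundary_end xi)].
Proof. exact: projT2 (cid (boundary_endP xi)). Qed.

Lemma boundary_end_bij : bijective boundary_end.
Proof.
have surj x : exists xi, boundary_end xi = x.
  have [u ux] := end_inhabited x.
  have ubd : boundary Y [set v | v @ \oo --> end_nbhs x].
    exists u; first exact: end_converges_to_infinity ux.
    apply/seteqP; split=> v /=.
      by move=> vx; split; [exact: end_converges_to_infinity vx|exact: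
        gromov_equivalent_end vx].
    move=> [cv uv]; have [y vy] := end_exists cv.
    by case: tight_span_inhabited => o _; rewrite (end_unique ux vy (uv o)).
  exists (SigSub (mem_set ubd)); case: tight_span_inhabited => o _.
  have ux' : set_val (SigSub (mem_set ubd) : boundary Y) u by [].
  rewrite boundary_endE in ux'.
  by apply/esym/(end_unique ux ux' (gromov_equivalent_end ux ux o)).
have /choice[g gK] := surj; exists g => // xi.
have e : set_val (g (boundary_end xi)) = set_val xi.
  by rewrite !boundary_endE gK.
exact: val_inj e.
Qed.

Lemma end_product_is_boundary_product o (xi eta : boundary Y) :
  is_boundary_product o xi eta
    (end_product o (boundary_end xi) (boundary_end eta)).
Proof.
move=> u v; rewrite !boundary_endE => /= ux vy; exact: gromov_product_cvg.
Qed.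

Lemma tight_span_boundary_continuous : boundary_continuous Y.
Proof.
by move=> o xi eta; exists (end_product o (boundary_end xi) (boundary_end eta));
  exact: end_product_is_boundary_product.
Qed.

(** Both classes contain sequences, so uniqueness of limits determines the value that [xget]
    picks. *)
Lemma boundary_distE o (xi eta : boundary Y) :
  boundary_dist o xi eta =
  (boundary_ker o (boundary_end xi) (boundary_end eta))%:E.
Proof.
have [l lP] := tight_span_boundary_continuous o xi eta.
have [u ux] := end_inhabited (boundary_end xi).
have [v vy] := end_inhabited (boundary_end eta).
have uxi : set_val xi u by rewrite boundary_endE.
have veta : set_val eta v by rewrite boundary_endE.
have -> : boundary_dist o xi eta =
    expeR (- end_product o (boundary_end xi) (boundary_end eta)).
  rewrite /boundary_dist /boundary_product;
    case: xgetP => [l' _ /= l'P|/(_ l)//].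
  congr (expeR (- _)).
  exact: (cvg_unique (@ereal_hausdorff R) (l'P _ _ uxi veta)
    (@gromov_product_cvg o _ _ _ _ ux vy)).
rewrite /end_product; have [->|xy] := eqVneq.
  by rewrite boundary_kerxx.
by rewrite boundary_kerE// -EFinN.
Qed.

(** Continuity of [boundary_ker o] puts a neighbourhood inside each ball, and [boundary_ker_sep]
    puts a ball inside each neighbourhood. *)
Lemma boundary_openP (V : set (boundary Y)) :
  boundary_open V <-> open (boundary_end @` V).
Proof.
case: tight_span_inhabited => o _; split=> [oV|oV o' xi Vxi].
  rewrite openE => _ [xi Vxi <-]; have [r r0 sub] := oV o xi Vxi.
  rewrite /interior /=.
  have : boundary_ker o (boundary_end xi) (boundary_end xi) < r.
    by rewrite boundary_kerxx.
  move=> /(cvgr_lt _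
    (@boundary_ker_continuous o (boundary_end xi, boundary_end xi))).
  move=> -[[A B] /= [xA xB] AB]; apply: filterS xB => y By.
  have [g _ gK] := boundary_end_bij; exists (g y) => //; apply: sub => /=.
  rewrite boundary_distE lte_fin gK.
  exact: (AB (boundary_end xi, y) (conj (nbhs_singleton xA) By)).
have Ux : nbhs (boundary_end xi) (boundary_end @` V).
  by apply: open_nbhs_nbhs; split => //; exists xi.
have [c c0 sep] := boundary_ker_sep o' Ux; exists c => // eta /=.
rewrite boundary_distE lte_fin => lt; apply: contrapT => nVeta.
have := sep (boundary_end eta); rewrite leNgt lt => /(_ _)/negP; apply => //.
by move=> [xi' Vxi' /(bij_inj boundary_end_bij) e]; rewrite e in Vxi'.
Qed.

End SpanBoundary.

(** * The kernel of a Möbius structure *)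

Section MoebiusKernel.
Context {R : realType} {X : topologicalType}.
Implicit Types (d : X -> X -> \bar R) (M : set (X -> X -> \bar R)).
Implicit Types (x y z u w : X).

Lemma cdist_pos d x y : is_semimetric d -> x != y -> 0 < cdist d x y.
Proof.
move=> sd xy; have := semimetric_pos sd xy; rewrite /cdist.
by case: (d x y) => [r| |]//=; rewrite ?eqxx ?ltr01// lte_fin.
Qed.

Lemma cdist_sym d x y : is_semimetric d -> cdist d x y = cdist d y x.
Proof. by move=> sd; rewrite /cdist (semimetric_sym sd). Qed.

Lemma cdist_diag d x : is_semimetric d -> cdist d x x = 0.
Proof. by move=> sd; rewrite /cdist (semimetric_diag sd). Qed.

(** In each cross-ratio, numerator and denominator both acquire the factor
    [s x * s y * s z * s u]. *)
Lemma moebius_equiv_scale d d' (s : X -> R) : is_semimetric d ->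
  (forall x, 0 < s x) ->
  (forall x y, x != y -> cdist d' x y = s x * s y * cdist d x y) ->
  moebius_equiv d d'.
Proof.
move=> sd s0 dd' x y z u xyzu.
have sn0 v : s v != 0 by rewrite gt_eqF.
move: xyzu; rewrite /= !inE !negb_or.
move=> /and4P[/and3P[xy xz xu] /andP[yz yu] zu _].
have dn0 v v' : v != v' -> cdist d v v' != 0.
  by move=> /(cdist_pos sd)/gt_eqF ->.
rewrite /cr1 /cr2 /cr3 /cprod !dd'//.
split; field; rewrite ?dn0 ?sn0//.
Qed.

Lemma moebius_equiv_trans d1 d2 d3 :
  moebius_equiv d1 d2 -> moebius_equiv d2 d3 -> moebius_equiv d1 d3.
Proof.
by move=> h1 h2 x y z u q; have [-> -> ->] := h1 x y z u q; exact: h2.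
Qed.

Lemma moebius_equiv_sym d1 d2 : moebius_equiv d1 d2 -> moebius_equiv d2 d1.
Proof. by move=> h x y z u q; have [-> -> ->] := h x y z u q. Qed.

(** Metric inversion at [w], which sends [w] to infinity. *)
Definition invert (e : X -> X -> R) w x y : R := e x y / (e x w * e y w).

Definition inverted (e : X -> X -> R) w x y : \bar R :=
  if x == y then 0%E else if (x == w) || (y == w) then +oo%E
  else (invert e w x y)%:E.

Lemma inverted_semimetric (e : X -> X -> R) w : (forall x y, e x y = e y x) ->
  (forall x y, x != y -> 0 < e x y) ->
  (forall s : seq X, exists x, x \notin s) ->
  is_semimetric (inverted e w).
Proof.
move=> esym epos infX; split; rewrite /inverted.
- move=> x y; rewrite eq_sym; case: ifP => // _; rewrite orbC;
  case: ifP => // _.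
  by rewrite /invert esym (mulrC (e x w)).
- by move=> x; rewrite eqxx.
- move=> x y xy; rewrite (negbTE xy); case: ifPn => [_|]; first exact: ltry.
  by rewrite negb_or => /andP[xw yw]; rewrite lte_fin divr_gt0 ?mulr_gt0 ?epos.
- move=> x y; have [//|xy] := eqVneq x y.
  case: ifPn => // /orP[/eqP ->|/eqP ->] _; [left|right] => z zw;
    by rewrite (negbTE zw) eqxx orbT.
- suff H w' : infinitely_remote (inverted e w) w' -> w' = w.
    by move=> w1 w2 /H -> /H ->.
  (* A third point is needed: of two points at infinite distance, with no others, both would be
     infinitely remote. *)
  move=> rw'; have [x] := infX [:: w; w'];
    rewrite !inE negb_or => /andP[xw xw'].
  have := rw' x xw'; rewrite /inverted (negbTE xw') (negbTE xw)/=.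
  by case: eqVneq.
Qed.

(** The cancellation convention matches the factor 1 at [w]: for [x = w] the right-hand side is
    [e w y / e y w = 1]. *)
Lemma cdist_inverted (e : X -> X -> R) w x y : (forall x y, e x y = e y x) ->
  (forall x y, x != y -> 0 < e x y) -> x != y ->
  let s x := if x == w then 1 else (e x w)^-1 in
  cdist (inverted e w) x y = s x * s y * e x y.
Proof.
move=> esym epos xy /=; rewrite /cdist /inverted (negbTE xy).
have [xw|xw] := eqVneq x w; rewrite ?eqxx/=.
  have [yw|yw] := eqVneq y w; first by rewrite xw yw eqxx in xy.
  by rewrite xw (esym w) mul1r mulVf ?gt_eqF ?epos.
have [yw|yw] := eqVneq y w;
  first by rewrite yw eqxx mulr1 mulVf ?gt_eqF -?yw ?epos.
by rewrite /= /invert invfM mulrC.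
Qed.

Variables (M : set (X -> X -> \bar R)) (e : X -> X -> R).
Hypotheses (infX : forall s : seq X, exists x, x \notin s)
  (e_sym : forall x y, e x y = e y x) (e_diag : forall x, e x x = 0)
  (e_pos : forall x y, x != y -> 0 < e x y)
  (e_ptolemy : forall x y z u, e x y * e z u <= e x z * e y u + e x u * e y z)
  (M_inverted : forall w, M (inverted e w))
  (M_open : forall U : set X, moebius_open M U -> open U).

(** Ptolemy's inequality for [x, y, z, w], divided by [e x w * e y w * e z w]. *)
Lemma invert_triangle w x y z : x != w -> y != w -> z != w ->
  invert e w x y <= invert e w x z + invert e w y z.
Proof.
move=> xw yw zw; have ex := e_pos xw; have ey := e_pos yw; have ez := e_pos zw.
have h := e_ptolemy x y z w.
have -> : invert e w x z + invert e w y z =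
  (e x z * e y w + e x w * e y z) / (e x w * e y w * e z w).
  by rewrite /invert; field; rewrite !gt_eqF.
have -> : invert e w x y = e x y * e z w / (e x w * e y w * e z w).
  by rewrite /invert; field; rewrite !gt_eqF.
by rewrite ler_pM2r// invr_gt0 !mulr_gt0.
Qed.

Lemma invert_sym w x y : invert e w x y = invert e w y x.
Proof. by rewrite /invert e_sym (mulrC (e x w)). Qed.

(** Balls of [inverted e w] belong to the subbase of the Möbius topology, so [M_open] makes them
    open in [X]. *)
Lemma invert_near w x (r : R) : x != w -> 0 < r ->
  \forall y \near x, y != w /\ invert e w x y < r.
Proof.
move=> xw r0; pose B := [set y | (inverted e w x y < r%:E)%E].
have xB : nbhs x B.
  apply: open_nbhs_nbhs; split; last by rewrite /B /= /inverted eqxx lte_fin.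
  apply: M_open; exists [set B]; last by rewrite bigcup_set1.
  move=> _ ->; apply: finI_from1 => //.
  exists (inverted e w), w, x, r; split => // y yw.
  by rewrite /inverted (negbTE yw) eqxx orbT.
apply: filterS xB => y; rewrite /B /= /inverted.
have [<-|xy] := eqVneq x y; first by rewrite /invert e_diag mul0r.
rewrite (negbTE xw) /=; case: ifPn => //.
Qed.

Lemma invert_continuous w p : p.1 != w -> p.2 != w ->
  {for p, continuous (fun q : X * X => invert e w q.1 q.2)}.
Proof.
move: p => [x y] /= xw yw; apply/cvgrPdist_lt => r r0.
have r20 : 0 < r / 2 by rewrite divr_gt0.
exists ([set z | z != w /\ invert e w x z < r / 2],
        [set z | z != w /\ invert e w y z < r / 2]).
  by split; exact: invert_near.
move=> [x' y'] /= [[x'w h1] [y'w h2]].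
have := invert_triangle xw yw y'w; have := invert_triangle xw y'w x'w.
have := invert_triangle x'w y'w yw; have := invert_triangle x'w yw xw.
rewrite !(invert_sym w y') (invert_sym w x' x) (invert_sym w y x) => ? ? ? ?.
rewrite ltr_distl; apply/andP; split; lra.
Qed.

(** * Normalisation to a continuous kernel *)

Variables (a b : X).
Hypothesis ab : a != b.

(** [e] will be [cdist d0], which has the conventional value 1 at an infinitely remote point and
    need not be continuous. Two base points keep the divisor positive everywhere. *)
Definition weight x := e x a + e x b.

Lemma e_ge0 x y : 0 <= e x y.
Proof. by have [->|/e_pos/ltW//] := eqVneq x y; rewrite e_diag. Qed.

Lemma weight_gt0 x : 0 < weight x.
Proof.
rewrite /weight; have [->|/e_pos xa] := eqVneq x a;
  first by rewrite e_diag add0r e_pos.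
by have := e_ge0 x b; lra.
Qed.

(* Near any pair of points, [normalized] is expressed by [invert e w] with [w]
   away from that pair; [invert e w] is a metric off [w], by Ptolemy, and its
   balls are open, by (T). *)
Definition normalized x y := e x y / (weight x * weight y).

Lemma normalized_continuous : continuous (fun q : X * X => normalized q.1 q.2).
Proof.
move=> [x y]; have [w] := infX [:: x; y; a; b].
rewrite !inE !negb_or 4!(eq_sym w) => /and4P[xw yw aw bw].
(* [mu z] is [weight z] divided by [e z w]; these factors cancel in [normalized], leaving only
   continuous inversions. *)
pose mu z := invert e w z a * e a w + invert e w z b * e b w.
have muE z : z != w -> weight z = e z w * mu z.
  move=> zw; have := e_pos zw; have := e_pos aw; have := e_pos bw => ? ? ?.
  by rewrite /weight /mu /invert; field; rewrite !gt_eqF.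
have mu_gt0 z : z != w -> 0 < mu z.
  by move=> zw; have := weight_gt0 z; rewrite muE// pmulr_rgt0 ?e_pos.
have inv_cvg c z : c != w -> z != w ->
    invert e w z' c @[z' --> z] --> invert e w z c.
  move=> cw zw.
  apply: (@continuous_comp _ _ _ (fun z' => (z', c))
    (fun q : X * X => invert e w q.1 q.2)).
    by apply: cvg_pair => //; exact: cvg_cst.
  exact: invert_continuous.
have mu_cvg z : z != w -> mu z' @[z' --> z] --> mu z.
  by move=> zw; apply: cvgD; apply: cvgMl; exact: inv_cvg.
have : (invert e w q.1 q.2 / (mu q.1 * mu q.2)) @[q --> (x, y)] -->
    invert e w x y / (mu x * mu y).
  apply: cvgM; first exact: (@invert_continuous w (x, y)).
  apply: cvgV; first by rewrite gt_eqF// mulr_gt0 ?mu_gt0.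
  apply: cvgM.
    by apply: (@continuous_comp _ _ _ fst mu (x, y));
      [exact: cvg_fst|exact: mu_cvg].
  by apply: (@continuous_comp _ _ _ snd mu (x, y));
    [exact: cvg_snd|exact: mu_cvg].
have E z z' : z != w -> z' != w ->
    invert e w z z' / (mu z * mu z') = normalized z z'.
  move=> zw z'w; rewrite /normalized !muE// /invert.
  have := e_pos zw; have := e_pos z'w; have := mu_gt0 _ zw;
    have := mu_gt0 _ z'w => ? ? ? ?.
  by field; rewrite !gt_eqF.
rewrite E//=; apply: cvg_trans; apply: near_eq_cvg.
exists ([set z | z != w], [set z | z != w]) => /=.
  by split; [have := invert_near xw ltr01|have := invert_near yw ltr01];
    apply: filterS => z [].
by move=> [z z'] /= [zw z'w]; rewrite E.
Qed.

(** Transparent, so that the kernel later unfolds to [normalized]. *)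
Definition normalized_ptolemaic (cX : compact [set: X]) : ptolemaic R X.
Proof.
apply: (@Ptolemaic R X normalized) => //.
- by move=> x y; rewrite /normalized e_sym (mulrC (weight x)).
- by move=> x; rewrite /normalized e_diag mul0r.
- by move=> x y xy; rewrite divr_gt0 ?mulr_gt0 ?weight_gt0 ?e_pos.
- move=> x y z u; rewrite /normalized.
  have := weight_gt0 x; have := weight_gt0 y; have := weight_gt0 z;
    have := weight_gt0 u.
  move=> hu hz hy hx.
  pose q := (weight x * weight y * weight z * weight u)^-1.
  have q0 : 0 < q by rewrite invr_gt0 !mulr_gt0.
  have := ler_wpM2r (ltW q0) (e_ptolemy x y z u).
  by congr (_ <= _); rewrite /q; field; rewrite !gt_eqF.
- exact: normalized_continuous.
- by exists a, b.
Defined.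

End MoebiusKernel.

(** * The circle *)

Lemma set_type_compact (T : topologicalType) (A : set T) :
  compact A -> compact [set: A].
Proof.
move=> cA F PF _.
have FA : (set_val @ F) A.
  suff e : (set_val : A -> T) @^-1` A = setT by rewrite /fmap/= e;
    exact: filterT.
  by apply/seteqP; split=> // x _; exact: set_valP.
have [p [Ap clp]] := cA _ _ FA.
exists (SigSub (mem_set Ap)); split=> // B C FB [D [[E oE <-] Ep EC]].
have FsB : (set_val @ F) (set_val @` B) 
    by apply: (@filterS _ F _ B _ _ FB) => x Bx; exists x.
have [_ [[x Bx <-] Ex]] := clp _ _ FsB (open_nbhs_nbhs (conj oE Ep)).
by exists x; split => //; exact: EC.
Qed.

Section CircleTopology.
Context {R : realType}.

Lemma circle_compact : compact [set: circle R].
Proof.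
apply: set_type_compact.
apply: (@subclosed_compact _ _
  (`[-1, 1]%classic `*` `[-1, 1]%classic : set (R * R))).
- have -> : circle R = (fun p : R * R => p.1 ^+ 2 + p.2 ^+ 2) @^-1` [set 1].
    by apply/seteqP; split.
  apply: closed_comp => [p _|]; last exact: closed_eq.
  by apply: cvgD; [apply: (@cvgM _ _ _ _ fst fst); exact: cvg_fst
                 |apply: (@cvgM _ _ _ _ snd snd); exact: cvg_snd].
- by apply: compact_setX; exact: segment_compact.
- by move=> [x y]; rewrite /circle /= => xy; rewrite !in_itv/=; split; nra.
Qed.

Lemma circle_infinite (s : seq (circle R)) : exists p, p \notin s.
Proof.
(* Rational parametrisation of the circle at the natural numbers; the first coordinate alone
   determines [n]. *)
pose f (n : nat) : R * R :=
  ((1 - n%:R ^+ 2) / (1 + n%:R ^+ 2), 2 * n%:R / (1 + n%:R ^+ 2)).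
have pos n : 0 < 1 + n%:R ^+ 2 :> R by rewrite ltr_pwDl// sqr_ge0.
have fP n : circle R (f n).
  by rewrite /circle /=; field; rewrite gt_eqF.
pose g n : circle R := SigSub (mem_set (fP n)).
have g_inj : injective g.
  move=> m n /(congr1 set_val)/(congr1 fst) /= /eqP.
  rewrite eqr_div ?(lt0r_neq0 (pos _))// => /eqP e;
    have : (m%:R : R) ^+ 2 = n%:R ^+ 2 by lra.
  by move/eqP; rewrite eqrXn2// eqr_nat => /eqP.
apply: contrapT => H.
have : (size (map g (iota 0 (size s).+1)) <= size s)%N.
  apply: uniq_leq_size; first by rewrite map_inj_uniq// iota_uniq.
  by move=> p _; apply: contraT => ps; exfalso; apply: H; exists p.
by rewrite size_map size_iota ltnn.
Qed.

End CircleTopology.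

(** * Möbius structures under bijections, and the structure induced on the circle *)

Lemma moebius_equiv_pullback (R : realType) (X Z : choiceType) (f : Z -> X)
    (d d' : X -> X -> \bar R) : bijective f ->
  moebius_equiv (fun x y => d (f x) (f y)) (fun x y => d' (f x) (f y)) <->
  moebius_equiv d d'.
Proof.
move=> bf; split=> dd' x y z u q.
  have [g _ fgK] := bf.
  have := dd' (g x) (g y) (g z) (g u).
  rewrite /cr1 /cr2 /cr3 /cprod /cdist !fgK; apply.
  by move: q; rewrite -{1}(fgK x) -{1}(fgK y) -{1}(fgK z) -{1}(fgK u)
    -(map_inj_uniq (bij_inj bf)).
apply: dd'; by move: q; rewrite -(map_inj_uniq (bij_inj bf)).
Qed.

Lemma semimetric_pullback (R : realType) (X Z : choiceType) (f : Z -> X)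
    (d : X -> X -> \bar R) : bijective f ->
  is_semimetric (fun x y => d (f x) (f y)) <-> is_semimetric d.
Proof.
move=> bf; have [g gfK fgK] := bf.
have remote w : infinitely_remote (fun x y => d (f x) (f y)) w <->
    infinitely_remote d (f w).
  split=> h x xw; last by apply: h; rewrite (inj_eq (bij_inj bf)).
  by have := h (g x); rewrite fgK; apply; rewrite -(inj_eq (bij_inj bf)) fgK.
split=> -[sym diag pos inf uniq]; split.
- by move=> x y; have := sym (g x) (g y); rewrite !fgK.
- by move=> x; have := diag (g x); rewrite fgK.
- move=> x y xy; have := pos (g x) (g y); rewrite !fgK; apply.
  by rewrite (inj_eq (can_inj fgK)).
- move=> x y; have := inf (g x) (g y).
  by rewrite !remote !fgK.
- move=> x y; have := uniq (g x) (g y); rewrite !remote !fgK => h hx hy.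
  by rewrite -(fgK x) -(fgK y) h.
- by move=> x y.
- by move=> x.
- by move=> x y xy; apply: pos; rewrite (inj_eq (bij_inj bf)).
- by move=> x y /inf[] ?; [left|right]; apply/remote.
- by move=> x y /remote hx /remote hy; apply/(bij_inj bf)/uniq.
Qed.

(* Since cross-ratios only see [cdist d0], this finite function is itself in the
   Möbius class of [d0], whether or not [d0] has an infinitely remote point. *)
Lemma moebius_structure_ptolemaic (R : realType) (X : topologicalType)
    (d0 : X -> X -> \bar R) (M : set (X -> X -> \bar R)) :
  is_semimetric d0 -> M = [set d | is_semimetric d /\ moebius_equiv d0 d] ->
  compact [set: X] -> (forall s : seq X, exists x, x \notin s) ->
  (forall U : set X, moebius_open M U -> open U) ->
  (forall d, M d -> forall x y z u,
    cprod d x y z u <= cprod d x z y u + cprod d x u y z) ->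
  exists (k : ptolemaic R X) (s : X -> R), (forall x, 0 < s x) /\
    forall x y, k x y = s x * s y * cdist d0 x y.
Proof.
move=> sd0 ME cX infX M_open M_P; pose e := cdist d0.
have e_sym x y : e x y = e y x by exact: cdist_sym.
have e_diag x : e x x = 0 by exact: cdist_diag.
have e_pos x y : x != y -> 0 < e x y by exact: cdist_pos.
have e_ptolemy x y z u : e x y * e z u <= e x z * e y u + e x u * e y z.
  by apply: (M_P d0); rewrite ME.
have M_inverted w : M (inverted e w).
  rewrite ME; split; first exact: inverted_semimetric.
  apply: (@moebius_equiv_scale _ _ _ _
    (fun x => if x == w then 1 else (e x w)^-1)) => //.
    by move=> x; case: ifPn => // xw; rewrite invr_gt0 e_pos.
  by move=> x y xy; rewrite cdist_inverted.
have [a _] := infX [::]; have [b] := infX [:: a]; rewrite inE eq_sym => ab.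
exists (normalized_ptolemaic infX e_sym e_diag e_pos e_ptolemy
  M_inverted M_open ab cX).
exists (fun x => (weight e a b x)^-1); split.
  by move=> x; rewrite invr_gt0; exact: weight_gt0.
by move=> x y; rewrite /= /normalized invfM mulrC.
Qed.

Theorem theorem1p1 (R : realType) (alpha : R)
    (alpha_ge : Num.sqrt 2 - 1 <= alpha) (alpha_lt1 : alpha < 1)
    (M : set (circle R -> circle R -> \bar R))
    (M_moebius : is_moebius_structure M)
    (M_monotone : strictly_monotone alpha M)
    (M_increment : increment_axiom M) :
  exists Y : metricType R,
    [/\ metric_complete Y, metric_proper Y, geodesic Y,
        gromov_hyperbolic Y & boundary_continuous Y] /\
    exists f : boundary Y -> circle R,
      [/\ bijective f,
          (forall U : set (circle R), open U <-> boundary_open (f @^-1` U)) &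
          (forall d : circle R -> circle R -> \bar R,
             M d <-> induced_structure (fun xi eta => d (f xi) (f eta)))].
Proof.
have [d0 sd0 ME] := M_moebius; have [M_T _ M_P] := M_monotone.
have [k [s [s0 ks]]] := moebius_structure_ptolemaic sd0 ME circle_compact
  circle_infinite (fun U => (M_T U).1) M_P.
exists (tight_span k); split.
  split.
  - exact/proper_complete/tight_span_proper.
  - exact: tight_span_proper.
  - exact: tight_span_geodesic.
  - exact: tight_span_hyperbolic.
  - exact: tight_span_boundary_continuous.
have bf := boundary_end_bij k; exists (@boundary_end _ _ k); split=> // [U|d].
  rewrite boundary_openP image_preimage//.
  by have [g _ gK] := bf; apply/seteqP; split=> // x _; exists (g x).
(* For every base point [o] the boundary kernel rescales [d0], by the factors of [k] times
   [expR (- (o x / 2))]; all base points thus give the same Möbius class. *)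
have equiv (o : tight_span k) :
    moebius_equiv d0 (fun x y => (boundary_ker o x y)%:E).
  apply: (@moebius_equiv_scale _ _ _ _
    (fun x => s x * expR (- (o x / 2)))) => //.
    by move=> x; rewrite mulr_gt0 ?expR_gt0.
  move=> x y xy; rewrite {1}/cdist /= /boundary_ker ks.
  have -> : - ((o x + o y) / 2) = - (o x / 2) - o y / 2 by field.
  by rewrite expRD; ring.
have distE (o : tight_span k) : boundary_dist o =
    (fun xi eta => (boundary_ker o (boundary_end xi) (boundary_end eta))%:E).
  by apply/funext => xi; apply/funext => eta; exact: boundary_distE.
rewrite ME; split=> /= -[sd].
  move=> d0d; split; first exact/(semimetric_pullback d bf).
  case: (tight_span_inhabited k) => o _; exists o; rewrite distE.
  apply/(moebius_equiv_pullback (fun x y => (boundary_ker o x y)%:E) d bf).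
  exact: moebius_equiv_trans (moebius_equiv_sym (equiv o)) d0d.
case=> o; rewrite distE.
move=> /(moebius_equiv_pullback (fun x y => (boundary_ker o x y)%:E) d bf) od.
split; first exact: (semimetric_pullback d bf).1.
exact: moebius_equiv_trans (equiv o) od.
Qed.
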